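(* Let $-\infty<a<b<+\infty$, let $f:[a;b]\to\mathbb{R}$ be a càdlàg function and let $c>0$. Define $h^{0,c}:[a;b]\to\mathbb{R}$ by $$h^{0,c}(s)=f(a)+UTV^c(f,[a;s])-DTV^c(f,[a;s])-f(s).$$ Then $h^{0,c}(a)=0$, $\|h^{0,c}\|_{osc}\le c$, and for every $s\in(a;b]$ $$\inf\left\{TV(f+h,[a;s]) : h:[a;b]\to\mathbb{R},\ \|h\|_{osc}\le c\right\}=TV(f+h^{0,c},[a;s])=TV^c(f,[a;s]).$$ Moreover, $h^{0,c}$ is a càdlàg function and every point of discontinuity of $h^{0,c}$ is a point of discontinuity of $f$. Furthermore, $$TV^c(f,[a;b])=UTV^c(f,[a;b])+DTV^c(f,[a;b]).$$
   Context: $\|h\|_{osc}:=\sup_{s,u\in[a;b]}|h(s)-h(u)|$. For $a<s\le b$ all of the following suprema are over $n\geq 1$ and partitions $a\le t_0<t_1<\dots<t_n\le s$: total variation $TV(g,[a;s])=\sup\sum_{i=1}^n|g(t_i)-g(t_{i-1})|$; truncated variation $TV^c(f,[a;s])=\sup\sum_{i=1}^n\max\{|f(t_i)-f(t_{i-1})|-c,0\}$; upward truncated variation $UTV^c(f,[a;s])=\sup\sum_{i=1}^n\max\{f(t_i)-f(t_{i-1})-c,0\}$; downward truncated variation $DTV^c(f,[a;s])=\sup\sum_{i=1}^n\max\{f(t_{i-1})-f(t_i)-c,0\}$. On the degenerate interval $[a;a]$ all these quantities are $0$. Càdlàg means right-continuous with left limits. *)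

(* Defs.v *)
From mathcomp Require Import all_boot all_order all_algebra.
From mathcomp Require Import all_classical all_reals all_analysis.

Set Implicit Arguments.
Unset Strict Implicit.
Unset Printing Implicit Defensive.

Import Order.TTheory GRing.Theory Num.Theory.
Import numFieldNormedType.Exports.

Local Open Scope classical_set_scope.
Local Open Scope ring_scope.

(* A function [a;b] -> R is represented by a function R -> R; no definition
   below depends on its values outside [a;b] when a < b and s is in [a;b]. *)

Section TruncatedVariation.
Variable R : realType.
Implicit Types (a b c s x : R) (f g h : R -> R).

(* The points t_0 < ... < t_n are the first n+1 terms of t : nat -> R; the
   endpoints a and s need not be among them. *)
Definition is_partition a s (n : nat) (t : nat -> R) : Prop :=
  [/\ (1 <= n)%N, a <= t 0%N, t n <= s &
      forall i, (i < n)%N -> t i < t i.+1].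

(* The case distinction sets the value to 0 on [a;a], where there is no
   partition with n >= 1 (ereal_sup set0 would be -oo). *)
Definition partition_sup (phi : R -> R -> R) a s : \bar R :=
  if a < s then
    ereal_sup [set v | exists n t, is_partition a s n t /\
      v = (\sum_(1 <= i < n.+1) phi (t i.-1) (t i))%:E]
  else 0%E.

Definition TV g a s : \bar R :=
  partition_sup (fun x y => `|g y - g x|) a s.

Definition TVc c f a s : \bar R :=
  partition_sup (fun x y => Num.max (`|f y - f x| - c) 0) a s.

Definition UTVc c f a s : \bar R :=
  partition_sup (fun x y => Num.max (f y - f x - c) 0) a s.

Definition DTVc c f a s : \bar R :=
  partition_sup (fun x y => Num.max (f x - f y - c) 0) a s.

Definition osc a b h : \bar R :=
  ereal_sup [set v | exists s u, [/\ s \in `[a, b], u \in `[a, b] &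
                                     v = `|h s - h u|%:E]].

Definition cadlag a b f : Prop :=
  (forall x, x \in `[a, b[ -> f y @[y --> x^'+] --> f x) /\
  (forall x, x \in `]a, b] -> cvg (f y @[y --> x^'-])).

(* Continuity at x relative to [a;b], hence one-sided at the endpoints. *)
Definition continuous_at_in a b f x : Prop :=
  f y @[y --> within `[a, b] (nbhs x)] --> f x.

Definition discontinuity_point a b f x : Prop :=
  x \in `[a, b] /\ ~ continuous_at_in a b f x.

(* fine : \bar R -> R sends infinite values to 0, so this is the intended
   function only where UTVc and DTVc are finite. *)
Definition h0 c f a s : R :=
  f a + fine (UTVc c f a s) - fine (DTVc c f a s) - f s.

End TruncatedVariation.

(* Main.v *)
Require Import Defs.
From mathcomp Require Import all_boot all_order all_algebra.
From mathcomp Require Import all_classical all_reals all_analysis.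
From mathcomp Require Import lra.

Import Order.TTheory GRing.Theory Num.Theory.
Import numFieldNormedType.Exports.

Set Implicit Arguments.
Unset Strict Implicit.
Unset Printing Implicit Defensive.

Local Open Scope classical_set_scope.
Local Open Scope ring_scope.

(** Write u(s) and d(s) for the upward and downward truncated variations of f on
    [a;s]. Everything rests on three elementary facts about these suprema.

    - Exchange of steps. When an upward step and a downward step overlap, their
      end points can be recombined without changing the total gain, because both
      gains are linear in the values of f and both pay the same toll c. Cutting
      at a time t < s shows in this way that
      u(s) + d(t) + f(t) - f(s) - c <= d(s) + u(t) (lub_cross); this inequality
      for f and for -f says that the oscillation of u - d - f is at most c.
      Recombining a whole upward family with a whole downward one produces a
      single partition for the truncated variation (chain_merge), whence
      u + d <= TVc (lub_add_le_TVc).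

    - Sandwich. Adding h of oscillation at most c changes each increment of f by
      at most c, so TVc f <= TV (f + h) (TVc_le_TV). For h = h0 the sum f + h0
      is f(a) + u - d with u and d nondecreasing, so TV (f + h0) <= u + d
      (TV_le_lub). With u + d <= TVc f all these quantities coincide, and the
      infimum is attained at h0.

    - Local control. On an interval where f stays within e <= c/2 of its initial
      value, u grows by at most e (chain_flat), since steps inside the
      interval gain nothing and a step across its left end can be cut there. This
      gives finiteness of u by a supremum argument (cadlag_bounded), and it
      transfers one-sided and two-sided continuity from f to u.

    The downward variation of f is the upward variation of -f, so only the upward
    one is studied. *)

(** * Suprema over partitions as suprema over chains *)

(** A chain is a finite family of non-overlapping steps from p to q, in
    increasing order, with gaps allowed in between; [chain phi a k s v]
    says that some chain in [a;s] has k steps and total gain v. Letting gaps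
    replace the truncation at 0 makes the gains of steps linear in f, and the
    inductive form makes the last step accessible. *)
Inductive chain {R : realType} (phi : R -> R -> R) (a : R) :
    nat -> R -> R -> Prop :=
| chain0 s : a <= s -> chain phi a 0 s 0
| chainS k p q s v : chain phi a k p v -> p < q -> q <= s ->
    chain phi a k.+1 s (v + phi p q).

Definition chain_sup {R : realType} (phi : R -> R -> R) (a s : R) : \bar R :=
  ereal_sup [set v%:E | v in [set v | exists k, chain phi a k s v]].

Section Chains.
Context {R : realType}.
Implicit Types (a b c s t x v w : R) (phi psi : R -> R -> R) (f u d : R -> R).

Lemma chain_ge phi a k s v : chain phi a k s v -> a <= s.
Proof.
elim=> {k s v} [//|k p q s v _ ap pq qs].
by rewrite (le_trans ap)// (le_trans (ltW pq)).
Qed.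

Lemma chain_end0 phi a k v : chain phi a k a v -> v = 0.
Proof.
move E : {1}a => s C; case: C E => // k' p q s' v' /chain_ge ap pq qs sa.
by move: (le_lt_trans ap (lt_le_trans pq qs)); rewrite sa ltxx.
Qed.

Lemma chain_inv phi a k s v : chain phi a k s v ->
  (k = 0%N /\ v = 0) \/ exists k' p q v', [/\ k = k'.+1, v = v' + phi p q,
    chain phi a k' p v', p < q & q <= s].
Proof.
case=> {k s v} [s _|k p q s v C pq qs]; first by left.
by right; exists k, p, q, v.
Qed.

Lemma chain_weaken phi a k s t v :
  chain phi a k s v -> s <= t -> chain phi a k t v.
Proof.
case=> {k s v} [s as_ st|k p q s v C pq qs st].
  by apply: chain0; rewrite (le_trans as_).
by apply: chainS C pq _; rewrite (le_trans qs).
Qed.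

Lemma chain_mono phi psi a b k s v :
  (forall x y, a <= x -> x < y -> y <= b -> phi x y <= psi x y) ->
  s <= b -> chain phi a k s v -> exists2 w, v <= w & chain psi a k s w.
Proof.
move=> le_phi + C; elim: C => {k s v} [s as_ _|k p q s v C IH pq qs sb].
  by exists 0 => //; exact: chain0.
have [|w vw Cw] := IH; first by rewrite (le_trans (ltW pq))// (le_trans qs).
exists (w + psi p q); last exact: chainS Cw pq qs.
by rewrite lerD// le_phi ?(chain_ge C)// (le_trans qs).
Qed.

Lemma le_chain_sup phi a k s v :
  chain phi a k s v -> (v%:E <= chain_sup phi a s)%E.
Proof. by move=> C; apply: ereal_sup_ubound; exists v => //; exists k. Qed.

Lemma ge_chain_sup phi a s (M : \bar R) :
  (forall k v, chain phi a k s v -> (v%:E <= M)%E) -> (chain_sup phi a s <= M)%E.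
Proof. by move=> H; apply: ge_ereal_sup => _ [v [k C] <-]; exact: H C. Qed.

Definition psum phi (n : nat) (t : nat -> R) : R :=
  \sum_(1 <= i < n.+1) Num.max (phi (t i.-1) (t i)) 0.

Lemma psumS phi n (t : nat -> R) :
  psum phi n.+1 t = psum phi n t + Num.max (phi (t n) (t n.+1)) 0.
Proof. by rewrite /psum big_nat_recr. Qed.

(** Steps whose gain is negative are turned into gaps. *)
Lemma chain_psum phi a n (t : nat -> R) : a <= t 0%N ->
  (forall i, (i < n)%N -> t i < t i.+1) ->
  exists k, chain phi a k (t n) (psum phi n t).
Proof.
move=> at0; elim: n => [_|n IH incr].
  by exists 0%N; rewrite /psum big_nil; exact: chain0.
have [|k C] := IH; first by move=> i ni; apply: incr; rewrite ltnW.
have tn : t n < t n.+1 by exact: incr.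
rewrite psumS; case: (lerP (phi (t n) (t n.+1)) 0) => h.
  by exists k; rewrite addr0; apply: chain_weaken C (ltW tn).
by exists k.+1; apply: chainS C tn _.
Qed.

Lemma psum_append phi n (t : nat -> R) q : (forall i, (i < n)%N -> t i < t i.+1) ->
  t n < q -> exists t' : nat -> R, [/\ t' 0%N = t 0%N, t' n.+1 = q,
    forall i, (i < n.+1)%N -> t' i < t' i.+1 &
    psum phi n.+1 t' = psum phi n t + Num.max (phi (t n) q) 0].
Proof.
move=> incr tq; exists (fun i => if (i <= n)%N then t i else q).
split => /=; rewrite ?ltnn//.
  by move=> i; rewrite ltnS => i_n; rewrite i_n; case: ltnP => // ?;
    [exact: incr|have -> : i = n by apply/eqP; rewrite eqn_leq i_n].
rewrite psumS leqnn ltnn; congr (_ + _).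
by apply: eq_big_nat => i /andP[_]; rewrite ltnS => i_n;
   rewrite i_n (leq_trans (leq_pred i)).
Qed.

(** Filling the gaps of a chain with additional steps costs nothing, as
    truncated gains are nonnegative. The partition may have n = 0, but only
    when s = a. *)
Lemma psum_chain phi a k s v : chain phi a k s v ->
  exists n (t : nat -> R), [/\ t 0%N = a, t n = s,
    forall i, (i < n)%N -> t i < t i.+1 & v <= psum phi n t].
Proof.
have ext n (t : nat -> R) q s' : t 0%N = a -> t n = q ->
    (forall i, (i < n)%N -> t i < t i.+1) -> q <= s' ->
    exists m (t' : nat -> R), [/\ t' 0%N = a, t' m = s',
      forall i, (i < m)%N -> t' i < t' i.+1 & psum phi n t <= psum phi m t'].
  move=> t0 tn incr; rewrite le_eqVlt => /predU1P[<-|qs]; first by exists n, t.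
  rewrite -tn in qs; have [t' [t'0 t'n incr' E]] := psum_append phi incr qs.
  exists n.+1, t'; split => //; first by rewrite t'0.
  by rewrite E lerDl le_max lexx orbT.
elim=> {k s v} [s as_|k p q s v C [n [t [t0 tn incr vle]]] pq qs].
  have [||||m [t [? ? ? le]]] := ext 0%N (fun=> a) a s => //.
  by exists m, t; split => //; apply: le_trans le; rewrite /psum big_nil.
rewrite -tn in pq; have [t1 [t10 t1n incr1 E]] := psum_append phi incr pq.
have [||||m [t2 [? ? ? le]]] := ext n.+1 t1 q s => //; first by rewrite t10.
exists m, t2; split => //; apply: le_trans le; rewrite E -tn lerD//.
by rewrite le_max lexx.
Qed.

(** At s = a the only chain is the empty one, so that the convention for the
    degenerate interval holds for chains without a case distinction. *)
Lemma partition_supE phi a s : a <= s ->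
  partition_sup (fun x y => Num.max (phi x y) 0) a s = chain_sup phi a s.
Proof.
rewrite /partition_sup le_eqVlt => /predU1P[<-|as_].
  rewrite ltxx; apply/le_anti/andP; split.
    exact/le_chain_sup/chain0.
  by apply: ge_chain_sup => k v /chain_end0 ->.
rewrite as_; apply/le_anti/andP; split.
  apply: ge_ereal_sup => _ [n [t [[_ at0 tns incr] ->]]].
  have [k C] := chain_psum phi at0 incr.
  exact: le_chain_sup (chain_weaken C tns).
apply: ge_chain_sup => k v /psum_chain[n [t [t0 tn incr vle]]].
apply: (@le_trans _ _ (psum phi n t)%:E); first by rewrite lee_fin.
apply: ereal_sup_ubound; exists n, t; split => //; split => //.
- by case: n tn {incr vle} => //; rewrite t0 => E; rewrite E ltxx in as_.
- by rewrite t0.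
- by rewrite tn.
Qed.

(** * Merging an upward and a downward chain *)

Definition up_gain c f x y : R := f y - f x - c.
Definition tv_gain c f x y : R := `|f y - f x| - c.

Lemma UTVcE c f a s : a <= s -> UTVc c f a s = chain_sup (up_gain c f) a s.
Proof. exact: partition_supE. Qed.

Lemma DTVcE c f a s : DTVc c f a s = UTVc c (fun x => - f x) a s.
Proof.
rewrite /DTVc /UTVc; congr partition_sup; apply/funext => x; apply/funext => y.
by rewrite opprK (addrC (- f y)).
Qed.

Lemma TVcE c f a s : a <= s -> TVc c f a s = chain_sup (tv_gain c f) a s.
Proof. exact: partition_supE. Qed.

Lemma TVE f a s : a <= s -> TV f a s = chain_sup (tv_gain 0 f) a s.
Proof.
move=> as_; rewrite -TVcE//; congr partition_sup; apply/funext => x.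
by apply/funext => y; rewrite subr0; apply/esym/max_idPl.
Qed.

Lemma tv_gainN c f : tv_gain c (fun x => - f x) = tv_gain c f.
Proof.
by apply/funext => x; apply/funext => y; rewrite /tv_gain -opprD normrN.
Qed.

Lemma up_le_tv c f x y : up_gain c f x y <= tv_gain c f x y.
Proof. by rewrite lerD2r ler_norm. Qed.

(** The case x = q is allowed: no step can be added there, but the
    expected gain is then -c < 0. *)
Lemma tv_chain_ext c f a k r x q z : 0 < c ->
  chain (tv_gain c f) a k r z -> r <= x -> x <= q ->
  exists k' z', z + (f q - f x - c) <= z' /\ chain (tv_gain c f) a k' q z'.
Proof.
move=> c0 C rx; rewrite le_eqVlt => /predU1P[<-|xq].
  exists k, z; split; [lra|exact: chain_weaken C rx].
exists k.+1, (z + tv_gain c f x q); split; first by rewrite lerD2l up_le_tv.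
exact: chainS (chain_weaken C rx) xq _.
Qed.

(** Induction on the total number of steps. Let (p,q) and (p',q') be the last
    upward and downward steps; up to exchanging f and -f, q' <= q. If q' <= p,
    the upward step is simply kept for the end. Otherwise both gains, up from p to q
    and down from p' to q', are rewritten with the final upward step from q' to q
    and one step between p and p': downward from p' to p when p' < p, upward from
    p to p' when p < p'. In both cases the sum of the gains is kept, by
    (f q - f p - c) + (f p' - f q' - c) = (f q - f q' - c) + (f p' - f p - c),
    and the chains to which the induction hypothesis applies have one step
    fewer. *)
Lemma chain_merge c a : 0 < c -> forall N f k l s v w, (k + l <= N)%N ->
  chain (up_gain c f) a k s v -> chain (up_gain c (fun x => - f x)) a l s w ->
  exists m z, v + w <= z /\ chain (tv_gain c f) a m s z.
Proof.
move=> c0; elim=> [|N IH] f k l s v w klN Cv Cw.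
  case/chain_inv: (Cv) klN => [[-> ->]|[? [? [? [? [-> _ _ _ _]]]]] //].
  case/chain_inv: (Cw) => [[-> ->] _|[? [? [? [? [-> _ _ _ _]]]]] //].
  by exists 0%N, 0; split; [lra|exact: chain0 (chain_ge Cv)].
wlog: f k l v w klN Cv Cw / exists k' p q v',
    [/\ k = k'.+1, v = v' + up_gain c f p q,
       chain (up_gain c f) a k' p v', p < q & q <= s /\
    exists l' p' q' w', [/\ l = l'.+1, w = w' + up_gain c (fun x => - f x) p' q',
       chain (up_gain c (fun x => - f x)) a l' p' w', p' < q' & q' <= q]].
  move=> wl; have mono g := @chain_mono (up_gain c g) (tv_gain c g) a s _ s _
     (fun x y _ _ _ => up_le_tv c g x y) (lexx s).
  case/chain_inv: (Cv) => [[_ ->]|[k' [p [q [v' [ek ev C pq qs]]]]]].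
    have [z wz Cz] := mono _ _ _ Cw.
    by exists l, z; rewrite add0r -(tv_gainN c f).
  case/chain_inv: (Cw) => [[_ ->]|[l' [p' [q' [w' [el ew C' pq' qs']]]]]].
    have [z wz Cz] := mono _ _ _ Cv.
    by exists k, z; rewrite addr0.
  (* If q < q', the roles of f and -f are exchanged. *)
  have [q'q|/ltW qq'] := leP q' q.
    apply: wl klN Cv Cw _.
    by exists k', p, q, v'; split => //; split => //; exists l', p', q', w'.
  have fN : (fun x => - - f x) = f by apply/funext => x; rewrite opprK.
  rewrite addrC -(tv_gainN c f).
  apply: (wl (fun x => - f x) l k); rewrite ?fN //; first by rewrite addnC.
  exists l', p', q', w'; split => //; split => //.
  by exists k', p, q, v'.
case=> [k' [p [q [v' [ek ev Cv' pq [qs [l' [p' [q' [w' [el ew Cw' pq' q'q]]]]]]]]]]].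
rewrite ek el in klN Cw.
have ext m z x : x <= q' -> chain (tv_gain c f) a m x z ->
    v + w <= z + (f q - f q' - c) ->
    exists m z, v + w <= z /\ chain (tv_gain c f) a m s z.
  move=> xq' C le; have [m' [z' [le' C']]] := tv_chain_ext c0 C xq' q'q.
  by exists m', z'; split; [exact: le_trans le'|exact: chain_weaken C' qs].
rewrite ev ew /up_gain in ext *.
have [q'p|pq''] := leP q' p.
  have Cw1 : chain (up_gain c (fun x => - f x)) a l'.+1 p
      (w' + up_gain c (fun x => - f x) p' q').
    exact: chainS Cw' pq' q'p.
  have [|m [z [le C]]] := IH f k' l'.+1 p _ _ _ Cv' Cw1 => //.
  exists m.+1, (z + tv_gain c f p q); split; last exact: chainS C pq qs.
  by have := up_le_tv c f p q; move: le; rewrite /up_gain; lra.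
have [p'p|pp'] := ltP p' p.
  have Cw1 : chain (up_gain c (fun x => - f x)) a l'.+1 p
      (w' + up_gain c (fun x => - f x) p' p).
    exact: chainS Cw' p'p _.
  have [|m [z [le C]]] := IH f k' l'.+1 p _ _ _ Cv' Cw1 => //.
  apply: ext (ltW pq'') C _; move: le; rewrite /up_gain; lra.
(* When p = p' both last steps are dropped: the two gains add up to that of
   the step from q' to q, minus c. *)
move: pp'; rewrite le_eqVlt => /predU1P[E|pp'].
  rewrite -E in Cw' pq' ext *.
  have [|m [z [le C]]] := IH f k' l' p _ _ _ Cv' Cw' => //.
    by move: klN; rewrite addnS addSn ltnS => /ltnW.
  apply: ext (ltW pq') C _; lra.
have Cv1 : chain (up_gain c f) a k'.+1 p' (v' + up_gain c f p p').
  exact: chainS Cv' pp' _.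
have [|m [z [le C]]] := IH f k'.+1 l' p' _ _ _ Cv1 Cw' => //.
  by move: klN; rewrite addnS ltnS.
apply: ext (ltW pq') C _; move: le; rewrite /up_gain; lra.
Qed.

(** * Real-valued suprema of chains *)

Definition chain_bounded phi a s : Prop :=
  exists M : R, forall k v, chain phi a k s v -> v <= M.

(** u(s) is the least upper bound of the chains in [a;s]; used in place of a
    specific supremum so that arguments stay within real arithmetic. *)
Definition chain_lub phi a b u : Prop := forall s, a <= s -> s <= b ->
  (forall k v, chain phi a k s v -> v <= u s) /\
  (forall M, (forall k v, chain phi a k s v -> v <= M) -> u s <= M).

Lemma chain_bounded_fin phi a s : a <= s -> chain_bounded phi a s ->
  chain_sup phi a s \is a fin_num.
Proof.
move=> as_ [M leM]; rewrite ge0_fin_numE; last exact: le_chain_sup (chain0 _ as_).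
apply: (@le_lt_trans _ _ M%:E); last exact: ltry.
by apply: ge_chain_sup => k v /leM; rewrite lee_fin.
Qed.

Lemma fine_chain_lub phi a b :
  (forall s, a <= s -> s <= b -> chain_bounded phi a s) ->
  chain_lub phi a b (fun s => fine (chain_sup phi a s)).
Proof.
move=> bnd s as_ sb; have fs := chain_bounded_fin as_ (bnd s as_ sb).
split=> [k v C|M leM].
  by rewrite -lee_fin fineK//; exact: le_chain_sup C.
by rewrite -lee_fin fineK//; apply: ge_chain_sup => k v /leM; rewrite lee_fin.
Qed.

Lemma eq_chain_lub phi a b u u' :
  (forall s, a <= s -> u s = u' s) -> chain_lub phi a b u -> chain_lub phi a b u'.
Proof. by move=> E lu s as_ sb; rewrite -E//; exact: lu. Qed.

Section Lub.
Variables (phi : R -> R -> R) (a b : R) (u : R -> R).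
Hypothesis lub_u : chain_lub phi a b u.

Lemma lub_ub k s v : s <= b -> chain phi a k s v -> v <= u s.
Proof. by move=> sb C; have [le_u _] := lub_u (chain_ge C) sb; exact: le_u C. Qed.

Lemma lub_ge0 s : a <= s -> s <= b -> 0 <= u s.
Proof. by move=> as_ sb; exact: lub_ub sb (chain0 _ as_). Qed.

Lemma lub_homo s t : a <= s -> s <= t -> t <= b -> u s <= u t.
Proof.
move=> as_ st tb; have [_] := lub_u as_ (le_trans st tb); apply => k v C.
exact: lub_ub tb (chain_weaken C st).
Qed.

Lemma lub_step p q : a <= p -> p < q -> q <= b -> u p + phi p q <= u q.
Proof.
move=> ap pq qb; rewrite -lerBrDr.
have [_] := lub_u ap (le_trans (ltW pq) qb); apply => k v C.
by rewrite lerBrDr; apply: lub_ub qb (chainS C pq _).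
Qed.
End Lub.

(** Induction on the chain for u(s), adding the downward step from t to s to the
    one for d(t). If the last upward step (p,q) crosses t, it is exchanged for
    an upward step from p to t, which is available to u(t), and a downward step
    from q to s, which is available to d(s); if t < p, the exchange gives two downward
    steps from t to p and from q to s instead. *)
Lemma lub_cross c f a b u d t : 0 < c ->
  chain_lub (up_gain c f) a b u ->
  chain_lub (up_gain c (fun x => - f x)) a b d ->
  a <= t -> forall s, t < s -> s <= b ->
  u s + d t + f t - f s - c <= d s + u t.
Proof.
move=> c0 lu ld at_ s0 ts0 s0b.
suff H k s v : chain (up_gain c f) a k s v -> t < s -> s <= b ->
    v + d t + f t - f s - c <= d s + u t.
  have [_ lus] := lu s0 (ltW (le_lt_trans at_ ts0)) s0b.
  suff : u s0 <= d s0 + u t - d t - f t + f s0 + c by lra.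
  by apply: lus => k v /H /(_ ts0 s0b); lra.
have dstep p q (ap : a <= p) : p < q -> q <= b -> d p + (f p - f q - c) <= d q.
  by move=> pq qb; have := lub_step ld ap pq qb; rewrite /up_gain; lra.
elim=> {k s v} [s as_|k p q s v C IH pq qs] ts sb.
  have := lub_ge0 lu at_ (le_trans (ltW ts) sb).
  by have := dstep _ _ at_ ts sb; lra.
have ap := chain_ge C.
have tb : t <= b by rewrite (le_trans (ltW ts)).
have [qt|tq] := leP q t.
  have := lub_ub lu tb (chainS C pq qt).
  by have := dstep _ _ at_ ts sb; lra.
have qb : q <= b by rewrite (le_trans qs).
have dqs : d q + f q - f s - c <= d s.
  have [->|qs'] := eqVneq q s; first by lra.
  have qs'' : q < s by rewrite lt_neqAle qs'.
  by have := dstep _ _ (ltW (le_lt_trans ap pq)) qs'' sb; lra.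
have dtq := lub_homo ld at_ (ltW tq) qb.
have [pt|tp|pt] := ltgtP p t.
- have := lub_ub lu tb (chainS C pt (lexx t)); rewrite /up_gain; lra.
- have := IH tp (le_trans (ltW pq) qb).
  have := lub_homo ld ap (ltW pq) qb; rewrite /up_gain; lra.
- rewrite pt in C *; have := lub_ub lu tb C; rewrite /up_gain; lra.
Qed.

(** * Local control and finiteness *)

(** Steps inside [y;s] have gain at most 2e - c <= 0. A step from p < y to
    q > y is worth at most the step from p to y plus f q - f y <= e, and
    there is at most one such step. *)
Lemma chain_flat c f a y e M k s v : e + e <= c -> a <= y ->
  (forall j w, chain (up_gain c f) a j y w -> w <= M) ->
  y <= s -> (forall w, y <= w -> w <= s -> `|f w - f y| <= e) ->
  chain (up_gain c f) a k s v -> v <= M + e.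
Proof.
move=> ec ay leM + + C; elim: C => {k s v} [s as_|k p q s v C IH pq qs] ys flat.
  have := leM _ _ (chain0 _ ay); have := flat y (lexx y) ys.
  by rewrite subrr normr0; lra.
have e0 : 0 <= e by have := flat y (lexx y) ys; rewrite subrr normr0.
have [qy|yq] := leP q y.
  by have := leM _ _ (chainS C pq qy); lra.
have := flat q (ltW yq) qs; rewrite ler_norml => /andP[_ fq].
have [py|yp|E] := ltgtP p y.
- by have := leM _ _ (chainS C py (lexx y)); rewrite /up_gain; lra.
- have ps : p <= s by rewrite (le_trans (ltW pq)).
  have := flat p (ltW yp) ps; rewrite ler_norml => /andP[fp _].
  have : v <= M + e.
    by apply: IH (ltW yp) _ => w yw wp; apply: flat yw (le_trans wp ps).
  by rewrite /up_gain; lra.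
- by rewrite E in C *; have := leM _ _ C; rewrite /up_gain; lra.
Qed.

(** Here f may jump at the end point s: only the last step can end at s, and its
    excess gain is controlled by the jump. This carries boundedness through a
    left limit. *)
Lemma chain_jump c f a y e M k s v : 0 < e -> e + e <= c -> a <= y ->
  (forall j w, chain (up_gain c f) a j y w -> w <= M) ->
  y < s -> (forall w, y <= w -> w < s -> `|f w - f y| <= e) ->
  chain (up_gain c f) a k s v -> v <= M + e + e + `|f s - f y|.
Proof.
move=> e0 ec ay leM ys flat C.
have flat' j x w : y <= x -> x < s -> chain (up_gain c f) a j x w -> w <= M + e.
  move=> yx xs; apply: chain_flat ec ay leM yx _ => r yr rx.
  exact: flat yr (le_lt_trans rx xs).
have J := ler_norm (f s - f y); have J0 := normr_ge0 (f s - f y).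
case/chain_inv: C => [[_ ->]|[j [p [q [w [_ -> C pq qs]]]]]].
  by have := leM _ _ (chain0 _ ay); lra.
have ps : p < s by exact: lt_le_trans qs.
move: qs; rewrite le_eqVlt => /predU1P[E|qs].
  rewrite E in pq *; have [py|yp] := ltP p y.
    by have := leM _ _ (chainS C py (lexx y)); rewrite /up_gain; lra.
  have := flat p yp ps; rewrite ler_norml => /andP[fp _].
  by have := flat' _ _ _ yp ps C; rewrite /up_gain; lra.
have [qy|yq] := leP q y; first by have := leM _ _ (chainS C pq qy); lra.
by have := flat' _ _ _ (ltW yq) qs (chainS C pq (lexx q)); lra.
Qed.

Lemma cadlag_right a b f x e : cadlag a b f -> a <= x -> x < b -> 0 < e ->
  exists z, [/\ x < z, z <= b & forall w, x <= w -> w <= z -> `|f w - f x| <= e].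
Proof.
move=> [fr _] ax xb e0; have /cvgrPdist_le/(_ _ e0) : f y @[y --> x^'+] --> f x.
  by apply: fr; rewrite in_itv /= ax.
rewrite near_withinE => /nbhs_ballP[r /= r0 H].
have m0 : 0 < Num.min (r / 2) (b - x).
  by rewrite lt_min subr_gt0 xb divr_gt0.
have [m1 m2] : Num.min (r / 2) (b - x) <= r / 2 /\ Num.min (r / 2) (b - x) <= b - x.
  by rewrite !ge_min !lexx orbT.
exists (x + Num.min (r / 2) (b - x)); split; [lra|lra|move=> w xw wz].
move: xw; rewrite le_eqVlt => /predU1P[<-|xw].
  by rewrite subrr normr0 ltW.
rewrite distrC; apply: H => //; rewrite /ball /= ltr_norml; lra.
Qed.

Lemma cadlag_left a b f x e : cadlag a b f -> a < x -> x <= b -> 0 < e ->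
  exists y, [/\ a <= y, y < x & forall w w', y <= w -> w < x -> y <= w' ->
    w' < x -> `|f w - f w'| <= e].
Proof.
move=> [_ fl] ax xb e0; have e20 : 0 < e / 2 by rewrite divr_gt0.
have /cvg_ex[l /cvgrPdist_le/(_ _ e20)] : cvg (f y @[y --> x^'-]).
  by apply: fl; rewrite in_itv /= ax.
rewrite near_withinE => /nbhs_ballP[r /= r0 H].
have m0 : 0 < Num.min (r / 2) (x - a).
  by rewrite lt_min subr_gt0 ax divr_gt0.
have [m1 m2] : Num.min (r / 2) (x - a) <= r / 2 /\ Num.min (r / 2) (x - a) <= x - a.
  by rewrite !ge_min !lexx orbT.
exists (x - Num.min (r / 2) (x - a)); split; [lra|lra|move=> w w' yw wx yw' w'x].
have near_l z : x - Num.min (r / 2) (x - a) <= z -> z < x -> `|l - f z| <= e / 2.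
  by move=> yz zx; apply: H => //; rewrite /ball /= ltr_norml; lra.
have := near_l _ yw wx; have := near_l _ yw' w'x.
by rewrite !ler_norml => /andP[? ?] /andP[? ?]; lra.
Qed.

(** The set S of points s such that chains in [a;s] are bounded is an initial
    segment. It contains its supremum by the existence of left limits, and right
    continuity would extend it beyond the supremum if that were less than b. *)
Lemma cadlag_bounded a b c f : a < b -> 0 < c -> cadlag a b f ->
  forall s, a <= s -> s <= b -> chain_bounded (up_gain c f) a s.
Proof.
move=> ab c0 cf; have e0 : 0 < c / 2 by rewrite divr_gt0.
have ec : c / 2 + c / 2 <= c by lra.
pose S := [set s | [/\ a <= s, s <= b & chain_bounded (up_gain c f) a s]].
have Sa : S a.
  by split; [|exact: ltW|exists 0 => k v /chain_end0 ->].
have Sdown s t : a <= s -> s <= t -> S t -> S s.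
  move=> as_ st [at_ tb [M leM]]; split => //; first exact: le_trans tb.
  by exists M => k v C; apply: leM (chain_weaken C st).
have Sub : has_ubound S by exists b => s [].
have Ssup : has_sup S by split; [exists a|].
have le_sup s : S s -> s <= sup S by move=> Ss; exact: ub_le_sup.
have asup : a <= sup S by exact: le_sup.
have supb : sup S <= b by apply: ge_sup; [exists a|move=> s []].
have [_ _ [M leM]] : S (sup S).
  move: (asup); rewrite le_eqVlt => /predU1P[<-//|asup'].
  have [y0 [ay0 y0s flat]] := cadlag_left cf asup' supb e0.
  have sy0 : 0 < sup S - y0 by rewrite subr_gt0.
  have [y Sy] := sup_adherent sy0 Ssup.
  rewrite subKr => yy0; have [ay yb [M leM]] := Sy.
  move: (le_sup _ Sy); rewrite le_eqVlt => /predU1P[<-//|ys].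
  split => //; exists (M + c / 2 + c / 2 + `|f (sup S) - f y|) => k v.
  apply: (chain_jump e0 ec ay leM ys) => w yw ws.
  by apply: flat => //; [exact: le_trans (ltW yy0) yw|exact: ltW].
move=> s as_ sb; have [ss|sups] := leP s (sup S).
  by exists M => k v C; apply: leM (chain_weaken C ss).
have [z [supz zb flat]] := cadlag_right cf asup (lt_le_trans sups sb) e0.
have Sz : S z.
  split => //; first by rewrite (le_trans asup)// ltW.
  by exists (M + c / 2) => k v; exact: chain_flat ec asup leM (ltW supz) flat.
by have := le_sup _ Sz; rewrite leNgt supz.
Qed.

(** * Regularity inherited from f *)

Lemma cadlagN a b f : cadlag a b f -> cadlag a b (fun x => - f x).
Proof.
move=> [fr fl]; split=> x xab; first exact: cvgN (fr x xab).
by have /cvg_ex[l fxl] := fl x xab; apply/cvg_ex; exists (- l); exact: cvgN.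
Qed.

Section Modulus.
Variables (c : R) (f : R -> R) (a b : R) (u : R -> R).
Hypotheses (c0 : 0 < c) (lub_u : chain_lub (up_gain c f) a b u).

Lemma lub_flat y z e : e + e <= c -> a <= y -> y <= z -> z <= b ->
  (forall w, y <= w -> w <= z -> `|f w - f y| <= e) -> `|u z - u y| <= e.
Proof.
move=> ec ay yz zb flat; rewrite ger0_norm ?subr_ge0; last exact: (lub_homo lub_u).
rewrite lerBlDl; have [_] := lub_u (le_trans ay yz) zb; apply => k v.
apply: (chain_flat ec ay _ yz flat) => j w C.
exact: (lub_ub lub_u (le_trans yz zb) C).
Qed.

(** Control of f on the whole interval between x and w is needed, as u(w) - u(x)
    depends on all these values; the base point of the flatness estimate is
    its left end, whence the factor 2 when w < x. *)
Lemma lub_cvg (F : set_system R) (x : R) : Filter F -> a <= x -> x <= b ->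
  (forall e, 0 < e -> \forall w \near F, [/\ a <= w, w <= b &
     forall r, Num.min x w <= r -> r <= Num.max x w -> `|f r - f x| <= e]) ->
  u w @[w --> F] --> u x.
Proof.
move=> FF ax xb H; apply/cvgrPdist_le => e e0.
have m0 : 0 < Num.min (e / 2) (c / 4) by rewrite lt_min !divr_gt0.
have [m1 m2] : Num.min (e / 2) (c / 4) <= e / 2 /\
               Num.min (e / 2) (c / 4) <= c / 4.
  by rewrite !ge_min !lexx orbT.
apply: filterS (H _ m0) => w [aw wb flat].
have [xw|wx] := leP x w.
  rewrite distrC; apply: (@le_trans _ _ (Num.min (e / 2) (c / 4))); last lra.
  apply: lub_flat => //; first lra.
  by move=> r; move: flat; rewrite min_l// max_r// => flat; exact: flat.
rewrite min_r ?max_l ?(ltW wx)// in flat.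
apply: (@le_trans _ _ (Num.min (e / 2) (c / 4) + Num.min (e / 2) (c / 4))); last lra.
apply: lub_flat => //; [lra|exact: ltW|move=> r wr rx].
have := flat _ wr rx; have := flat _ (lexx w) (ltW wx).
by rewrite !ler_norml => /andP[? ?] /andP[? ?]; lra.
Qed.

Lemma lub_cvg_right x : cadlag a b f -> x \in `[a, b[ ->
  u y @[y --> x^'+] --> u x.
Proof.
move=> cf; rewrite in_itv /= => /andP[ax xb].
apply: (lub_cvg _ ax (ltW xb)) => e e0.
have [z [xz zb flat]] := cadlag_right cf ax xb e0.
near=> w; have xw : x < w by near: w; exact: nbhs_right_gt.
have wz : w <= z by near: w; exact: nbhs_right_le.
split; [exact: le_trans (ltW xw)|exact: le_trans zb|].
rewrite min_l ?max_r ?(ltW xw)// => r xr rw.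
exact: flat (le_trans rw wz).
Unshelve. all: by end_near. Qed.

Lemma lub_cvg_left x : x \in `]a, b] -> cvg (u y @[y --> x^'-]).
Proof.
rewrite in_itv /= => /andP[ax xb]; apply: nondecreasing_at_left_is_cvgr.
  near=> y; have ay : a < y by near: y; exact: nbhs_left_gt.
  move=> s t; rewrite !in_itv /= => /andP[ys sx] /andP[yt tx] st.
  by apply: (lub_homo lub_u) st _;
    [exact: le_trans (ltW ay) (ltW ys)|exact: le_trans (ltW tx) xb].
near=> y; have ay : a < y by near: y; exact: nbhs_left_gt.
exists (u x) => _ [t + <-]; rewrite /= in_itv /= => /andP[yt tx].
by apply: (lub_homo lub_u) (ltW tx) xb; exact: le_trans (ltW ay) (ltW yt).
Unshelve. all: by end_near. Qed.

Lemma lub_cvg_within x : x \in `[a, b] -> continuous_at_in a b f x ->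
  continuous_at_in a b u x.
Proof.
rewrite in_itv /= => /andP[ax xb] fx; apply: (lub_cvg _ ax xb) => e e0.
have /cvgrPdist_le/(_ _ e0) := fx.
rewrite !near_withinE => /nbhs_ballP[r /= r0 H].
apply/nbhs_ballP; exists r => //= w xw.
rewrite /= in_itv /= => /andP[aw wb]; split=> // t; rewrite ge_min le_max.
move=> /orP mt /orP tm; rewrite distrC; apply: H.
  move: xw; rewrite /ball /= !ltr_norml => /andP[? ?]; case: mt tm => ? [?|?]; lra.
by rewrite /= in_itv /=; case: mt tm => ? [?|?]; apply/andP; split; lra.
Qed.
End Modulus.

(** * Comparison of the variations *)

Lemma TVc_le_TV a b c f h s : (osc a b h <= c%:E)%E -> a <= s -> s <= b ->
  (TVc c f a s <= TV (f \+ h)%R a s)%E.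
Proof.
move=> oh as_ sb; rewrite TVcE// TVE//; apply: ge_chain_sup => k v C.
suff [w vw Cw] : exists2 w, v <= w & chain (tv_gain 0 (f \+ h)) a k s w.
  by apply: le_trans (le_chain_sup Cw); rewrite lee_fin.
apply: (chain_mono (b := b)) sb C => x y ax xy yb; rewrite /tv_gain subr0 /=.
have hxy : `|h x - h y| <= c.
  rewrite -lee_fin; apply: le_trans oh; apply: ereal_sup_ubound.
  exists x, y; split=> //; rewrite in_itv /=.
    by rewrite ax (le_trans (ltW xy)).
  by rewrite yb andbT (le_trans ax (ltW xy)).
have -> : f y - f x = (f y + h y - (f x + h x)) + (h x - h y) by lra.
by rewrite lerBlDr (le_trans (ler_normD _ _))// lerD2l.
Qed.

Lemma TV_le_lub phi psi a b f u d s : a <= s -> s <= b ->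
  chain_lub phi a b u -> chain_lub psi a b d ->
  (forall x y, a <= x -> x <= y -> y <= b ->
     `|f y - f x| <= u y - u x + (d y - d x)) ->
  (TV f a s <= (u s + d s)%:E)%E.
Proof.
move=> as_ + lu ld bnd; rewrite TVE// => sb.
apply: ge_chain_sup => k v C; rewrite lee_fin; move: sb.
elim: C => {k s v as_} [s as_|k p q s v C IH pq qs] sb.
  by rewrite addr_ge0 ?(lub_ge0 lu)// (lub_ge0 ld).
have ap := chain_ge C; have qb := le_trans qs sb.
have aq := le_trans ap (ltW pq).
have := IH (le_trans (ltW pq) qb); have := bnd _ _ ap (ltW pq) qb.
have := lub_homo lu aq qs sb; have := lub_homo ld aq qs sb.
by rewrite /tv_gain; lra.
Qed.

(** TVc is not known to be finite at this point, hence the passage through its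
    real upper bounds M. *)
Lemma lub_add_le_TVc c f a b u d s : 0 < c -> a <= s -> s <= b ->
  chain_lub (up_gain c f) a b u ->
  chain_lub (up_gain c (fun x => - f x)) a b d ->
  ((u s + d s)%:E <= TVc c f a s)%E.
Proof.
move=> c0 as_ sb lu ld; rewrite TVcE//.
have [_ leu] := lu s as_ sb; have [_ led] := ld s as_ sb.
suff H : forall M : R, (chain_sup (tv_gain c f) a s <= M%:E)%E -> u s + d s <= M.
  case E : (chain_sup _ _ _) (H) => [M| |] H'.
  - by rewrite lee_fin; exact: H'.
  - by rewrite leey.
  - by have := le_chain_sup (chain0 (tv_gain c f) as_); rewrite E.
move=> M leM; rewrite -lerBrDr; apply: leu => k v Cv.
rewrite lerBrDr -lerBrDl; apply: led => l w Cw; rewrite lerBrDl.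
have [m [z [vwz Cz]]] := chain_merge c0 (leqnn (k + l)) Cv Cw.
by apply: le_trans vwz _; rewrite -lee_fin; exact: le_trans (le_chain_sup Cz) leM.
Qed.

End Chains.

Theorem mainTheorem2 (R : realType) (a b c : R) (f : R -> R)
    (hab : a < b) (hf : cadlag a b f) (hc : 0 < c) :
  (forall s, s \in `[a, b] ->
     UTVc c f a s \is a fin_num /\ DTVc c f a s \is a fin_num) /\
  h0 c f a a = 0 /\
  (osc a b (h0 c f a) <= c%:E)%E /\
  (forall s, s \in `]a, b] ->
     ereal_inf [set TV (f \+ h) a s | h in
                  [set h : R -> R | (osc a b h <= c%:E)%E]]
       = TV (f \+ h0 c f a) a s /\
     TV (f \+ h0 c f a) a s = TVc c f a s) /\
  cadlag a b (h0 c f a) /\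
  (forall x, discontinuity_point a b (h0 c f a) x ->
     discontinuity_point a b f x) /\
  TVc c f a b = (UTVc c f a b + DTVc c f a b)%E.
Proof.
pose u s := fine (UTVc c f a s); pose d s := fine (DTVc c f a s).
have bu := cadlag_bounded hab hc hf.
have bd := cadlag_bounded hab hc (cadlagN hf).
have lu : chain_lub (up_gain c f) a b u.
  by apply: eq_chain_lub (fine_chain_lub bu) => s as_; rewrite /u UTVcE.
have ld : chain_lub (up_gain c (fun x => - f x)) a b d.
  by apply: eq_chain_lub (fine_chain_lub bd) => s as_; rewrite /d DTVcE UTVcE.
have h0E s : h0 c f a s = f a + u s - d s - f s by [].
have fin s : a <= s -> s <= b ->
    UTVc c f a s \is a fin_num /\ DTVc c f a s \is a fin_num.
  move=> as_ sb; rewrite DTVcE !UTVcE//.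
  by split; apply: chain_bounded_fin => //; [exact: bu|exact: bd].
have oh0 : (osc a b (h0 c f a) <= c%:E)%E.
  (* The exchange inequality for -f swaps u and d, giving the other bound. *)
  have cross t s : a <= t -> t < s -> s <= b -> `|h0 c f a t - h0 c f a s| <= c.
    move=> at_ ts sb; have := lub_cross hc lu ld at_ ts sb.
    have fN : (fun x => - - f x) = f by apply/funext => x; rewrite opprK.
    have := @lub_cross _ c (fun x => - f x) a b d u t hc ld.
    rewrite fN => /(_ lu at_ _ ts sb).
    by rewrite !h0E ler_norml; lra.
  apply: ge_ereal_sup => _ [s [t [+ + ->]]]; rewrite !in_itv /= lee_fin.
  move=> /andP[as_ sb] /andP[at_ tb]; have [st|ts|->] := ltgtP s t.
  - exact: cross.
  - by rewrite distrC; exact: cross.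
  - by rewrite subrr normr0 ltW.
have TV_ub s : a <= s -> s <= b ->
    (TV (f \+ h0 c f a)%R a s <= (u s + d s)%:E)%E.
  move=> as_ sb; apply: (TV_le_lub as_ sb lu ld) => x y ax xy yb.
  have := lub_homo lu ax xy yb; have := lub_homo ld ax xy yb.
  by rewrite /= !h0E ler_norml; lra.
have TVcE' s : a <= s -> s <= b -> TVc c f a s = (u s + d s)%:E /\
    TV (f \+ h0 c f a) a s = (u s + d s)%:E.
  move=> as_ sb; have T1 := TVc_le_TV f oh0 as_ sb.
  have T2 := lub_add_le_TVc hc as_ sb lu ld; have T3 := TV_ub s as_ sb.
  split; apply/le_anti; rewrite ?T2 ?T3 ?andbT /=.
    exact: le_trans T3.
  exact: le_trans T1.
split; first by move=> s; rewrite in_itv /= => /andP[as_ sb]; exact: fin.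
split.
  by rewrite h0E /u /d /UTVc /DTVc /partition_sup ltxx /=; lra.
split=> //; split.
  move=> s; rewrite in_itv /= => /andP[/ltW as_ sb].
  have [T1 T2] := TVcE' s as_ sb; split; last by rewrite T1 T2.
  apply/le_anti/andP; split; first by apply: ereal_inf_lbound; exists (h0 c f a).
  by apply: le_ereal_inf_tmp => _ [h /= oh <-]; rewrite T2 -T1; exact: TVc_le_TV oh as_ sb.
have h0fun : h0 c f a = (fun s => f a + u s - d s - f s) by [].
split; [|split].
- have [fr fl] := hf; split=> x xab; rewrite h0fun.
    have ux := lub_cvg_right hc lu hf xab.
    have dx := lub_cvg_right hc ld (cadlagN hf) xab.
    exact: (cvgB (cvgB (cvgD (cvg_cst (f a)) ux) dx) (fr x xab)).
  have ux := lub_cvg_left lu xab; have dx := lub_cvg_left ld xab.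
  exact: (is_cvgB (is_cvgB (is_cvgD (is_cvg_cst (f a)) ux) dx) (fl x xab)).
- move=> x [xab dx]; split=> // fx; apply: dx; rewrite /continuous_at_in h0fun.
  have fNx : continuous_at_in a b (fun x => - f x) x by exact: cvgN.
  have ux := lub_cvg_within hc lu xab fx.
  have dx := lub_cvg_within hc ld xab fNx.
  exact: (cvgB (cvgB (cvgD (cvg_cst (f a)) ux) dx) fx).
- have [-> _] := TVcE' b (ltW hab) (lexx b).
  have [fu fd] := fin b (ltW hab) (lexx b).
  by rewrite EFinD /u /d !fineK.
Qed.
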